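(* Let $T>0$, $\alpha>0$, $\beta>0$, $\sigma>0$, $u_1>0$, let $N$ be a positive integer and $R_0\ge 0$, and consider the optimal control problem $$\int_0^T\big(\alpha R(t)+\beta u(t)\big)\,dt\to\inf,\qquad \dot R(t)=-u(t)R(t)+N\sigma^2,\qquad R(0)=R_0,\qquad 0\le u(t)\le u_1 .$$ Assume $\sqrt{\alpha N\sigma^2/\beta}\le u_1$ and set $u_s=\sqrt{\alpha N\sigma^2/\beta}$. Then the optimal control $\hat u$ has one of the following forms (which one depends on $R_0$ and $T$), for some $0<t_1<t_2<T$: (2.1) $\hat u(t)=0$ for $t\in(0,T)$; (2.2) $\hat u(t)=u_1$ on $(0,t_1)$ and $\hat u(t)=0$ on $(t_1,T)$; (2.3) $\hat u(t)=u_s$ on $(0,t_1)$ and $\hat u(t)=0$ on $(t_1,T)$; (2.4) $\hat u(t)=0$ on $(0,t_1)$, $\hat u(t)=u_s$ on $(t_1,t_2)$, $\hat u(t)=0$ on $(t_2,T)$; (2.5) $\hat u(t)=u_1$ on $(0,t_1)$, $\hat u(t)=u_s$ on $(t_1,t_2)$, $\hat u(t)=0$ on $(t_2,T)$. In particular, the number of switchings of the optimal control does not exceed two, and the optimal control may contain singular arcs (on which $\hat u=u_s$), as in cases (2.3)–(2.5).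
   Context: Admissible controls are functions $u\in L^\infty[0,T]$ with $0\le u(t)\le u_1$ for a.e. $t$ (identified up to a.e. equality); the corresponding state $R$ is the absolutely continuous solution of $\dot R=-uR+N\sigma^2$, $R(0)=R_0$. An optimal control is an admissible control minimizing the integral functional. *)

(* Defs.v *)
From HB Require Import structures.
From mathcomp Require Import all_boot all_order all_algebra.
From mathcomp Require Import all_classical all_reals all_analysis.
Set Implicit Arguments. Unset Strict Implicit. Unset Printing Implicit Defensive.
Import Order.TTheory GRing.Theory Num.Theory.
Import numFieldNormedType.Exports.
Local Open Scope classical_set_scope.
Local Open Scope ring_scope.

Section Control.
Variable R : realType.
Local Notation mu := (@lebesgue_measure R).

Definition admissible (T u1 : R) (u : R -> R) : Prop :=
  measurable_fun `[0, T] u /\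
  {ae mu, forall t, t \in `[0, T] -> 0 <= u t <= u1}.

(* x is the absolutely continuous solution of x' = - u x + N sigma^2,
   x(0) = R0 on [0,T], written in (equivalent) integral form *)
Definition is_state (T R0 N sigma : R) (u x : R -> R) : Prop :=
  {within `[0, T], continuous x} /\
  forall t, t \in `[0, T] ->
    x t = R0 + \int[mu]_(s in `[0, t]) (- u s * x s + N * sigma ^+ 2).

Definition cost (T alpha beta : R) (u x : R -> R) : \bar R :=
  (\int[mu]_(t in `[0%R, T]) ((alpha * x t + beta * u t)%R)%:E)%E.

Definition optimal (T alpha beta sigma u1 R0 N : R) (u x : R -> R) : Prop :=
  admissible T u1 u /\ is_state T R0 N sigma u x /\
  forall v y, admissible T u1 v -> is_state T R0 N sigma v y ->
    (cost T alpha beta u x <= cost T alpha beta v y)%E.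

Definition ae_const_on (a b c : R) (u : R -> R) : Prop :=
  {ae mu, forall t, t \in `]a, b[ -> u t = c}.

End Control.

(* Main.v *)
(* The Pontryagin principle is obtained from an exact identity: if x and y are
   the states of u and v, and q' = u q - alpha, q(T) = 0 is the costate of u,
   then J(v) - J(u) = int (beta - q y)(v - u). Perturbing u towards the
   bang-bang control gives u = u1 where S := q x exceeds beta and u = 0 where
   S < beta. Now S' = c q - alpha x and S'' = u (c q + alpha x) - 2 alpha c
   (c = N sigma^2), so S is concave on {S < beta}, and, because
   sqrt (alpha c / beta) <= u1, convex on {S > beta}. Hence S has no interior
   dip below beta and no interior bump above it; as S(T) = 0, the set
   {S = beta} is an interval, on which S' = S'' = 0 forces
   u = sqrt (alpha c / beta). *)
Require Import Defs.
From mathcomp Require Import all_boot all_order all_algebra.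
From mathcomp Require Import all_classical all_reals all_analysis.
From mathcomp Require Import measurable_realfun ring lra.
Import Order.TTheory GRing.Theory Num.Theory.
Import numFieldNormedType.Exports.
Local Open Scope ring_scope.

Set Implicit Arguments.
Unset Strict Implicit.
Unset Printing Implicit Defensive.

(** * Integrals over segments of bounded measurable functions *)

Section BoundedMeasurable.
Context {R : realType}.
Local Notation mu := (@lebesgue_measure R).
Implicit Types (a b s t r M K : R) (f g F G : R -> R).

(** A control is only measurable, so states and costates have derivatives only almost everywhere.
    Calculus is therefore done with the relation [primitive_on], and its product and chain rules
    rest on one principle: an increment error that is additive over intervals and at most quadratic
    in their length is zero. The cost identity contains the state [y] of the competitor instead of
    [x]. It yields a condition on [u] alone after inserting competitors [u + eps (w - u)], for which
    [y - x] is of order [eps]. The bound on [u1] enters through AM-GM: where S > beta the control is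
    [u1], and c q + alpha x >= 2 sqrt (alpha c S) makes S'' nonnegative as soon as u1^2 S >= alpha
    c, which follows from S > beta and u1^2 beta >= alpha c. *)

Definition bounded_measurable a b f :=
  measurable_fun `[a, b]%classic f /\
  exists M, forall t, a <= t <= b -> `|f t| <= M.

(** Integral form of: [F] is Lipschitz with almost everywhere derivative [f]. It tolerates jumps of
    [f], hence bang-bang controls. *)
Definition primitive_on a b f F :=
  bounded_measurable a b f /\
  forall s t, a <= s -> s <= t -> t <= b ->
    F t - F s = \int[mu]_(r in `[s, t]) f r.

Lemma ae_imply (P Q : R -> Prop) : (forall t, P t -> Q t) ->
  {ae mu, forall t, P t} -> {ae mu, forall t, Q t}.
Proof. by move=> PQ; apply: filterS => //; exact: (ae_filter_ringOfSetsType mu). Qed.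

Lemma ae_imply2 (P P' Q : R -> Prop) : (forall t, P t -> P' t -> Q t) ->
  {ae mu, forall t, P t} -> {ae mu, forall t, P' t} -> {ae mu, forall t, Q t}.
Proof. by move=> PQ; apply: filterS2 => //; exact: (ae_filter_ringOfSetsType mu). Qed.

Lemma bounded_measurableS a b s t f : a <= s -> t <= b ->
  bounded_measurable a b f -> bounded_measurable s t f.
Proof.
move=> as_ tb [mf [M fM]]; split.
  apply: measurable_funS mf => // x /=; rewrite !in_itv/= => /andP[sx xt].
  by rewrite (le_trans as_ sx) (le_trans xt tb).
exists M => x /andP[sx xt]; apply: fM.
by rewrite (le_trans as_ sx) (le_trans xt tb).
Qed.

Lemma bounded_measurable_cst a b r : bounded_measurable a b (fun=> r).
Proof. by split; [exact: measurable_cst|exists `|r|]. Qed.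

Lemma bounded_measurableD a b f g : bounded_measurable a b f ->
  bounded_measurable a b g -> bounded_measurable a b (fun t => f t + g t).
Proof.
move=> [mf [M fM]] [mg [K gK]]; split; first exact: (measurable_funD mf mg).
exists (M + K) => t abt; apply: (le_trans (ler_normD _ _)).
by rewrite lerD ?fM ?gK.
Qed.

Lemma bounded_measurableM a b f g : bounded_measurable a b f ->
  bounded_measurable a b g -> bounded_measurable a b (fun t => f t * g t).
Proof.
move=> [mf [M fM]] [mg [K gK]]; split; first exact: measurable_funM.
by exists (M * K) => t abt; rewrite normrM ler_pM ?fM ?gK.
Qed.

Lemma bounded_measurableZ a b r f : bounded_measurable a b f ->
  bounded_measurable a b (fun t => r * f t).
Proof. by move=> bf; apply: bounded_measurableM => //; apply: bounded_measurable_cst. Qed.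

Lemma bounded_measurableN a b f : bounded_measurable a b f ->
  bounded_measurable a b (fun t => - f t).
Proof.
move=> [mf [M fM]]; split; first exact: measurableT_comp.
by exists M => t abt; rewrite normrN fM.
Qed.

Lemma bounded_measurableB a b f g : bounded_measurable a b f ->
  bounded_measurable a b g -> bounded_measurable a b (fun t => f t - g t).
Proof. by move=> bf bg; apply: bounded_measurableD bf _; apply: bounded_measurableN. Qed.

Lemma bounded_measurable_integrable a b f : bounded_measurable a b f ->
  mu.-integrable `[a, b]%classic (EFin \o f).
Proof.
move=> [mf [M fM]]; apply: measurable_bounded_integrable => //.
  by rewrite /= lebesgue_measure_itv /=; case: ifPn => // _; rewrite -EFinB ltry.
exists M; split; first exact: num_real.
move=> x Mx y /=; rewrite in_itv /= => aby.
by rewrite (le_trans (fM _ aby)) ?ltW.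
Qed.

Lemma lebesgue_measure_segment s t : s <= t ->
  fine (mu `[s, t]%classic) = t - s.
Proof.
rewrite le_eqVlt => /predU1P[->|st].
  by rewrite lebesgue_measure_itv /= lte_fin ltxx subrr.
by rewrite lebesgue_measure_itv /= lte_fin st.
Qed.

Lemma integral_segment_cst s t r : s <= t ->
  \int[mu]_(_ in `[s, t]) r = r * (t - s).
Proof. by move=> st; rewrite Rintegral_cst //= lebesgue_measure_segment. Qed.

Lemma integral_segment_split s t r f : bounded_measurable s t f ->
  s <= r -> r <= t ->
  \int[mu]_(x in `[s, t]) f x =
  \int[mu]_(x in `[s, r]) f x + \int[mu]_(x in `[r, t]) f x.
Proof.
move=> bf sr rt.
have itf := bounded_measurable_integrable bf.
have := @Rintegral_itvB _ f (BLeft s) (BRight t) r itf sr rt.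
rewrite Rintegral_itv_obnd_cbnd; last first.
  by apply: integrableS itf => //; apply: subset_itvr; rewrite bnd_simp.
by move=> <-; rewrite addrC subrK.
Qed.

Lemma ler_integral_segment s t f g : bounded_measurable s t f ->
  bounded_measurable s t g -> (forall r, s <= r <= t -> f r <= g r) ->
  \int[mu]_(r in `[s, t]) f r <= \int[mu]_(r in `[s, t]) g r.
Proof.
move=> bf bg fg; apply: le_Rintegral => //; exact: bounded_measurable_integrable.
Qed.

Lemma integral_segmentD s t f g : bounded_measurable s t f ->
  bounded_measurable s t g ->
  \int[mu]_(r in `[s, t]) (f r + g r) =
  \int[mu]_(r in `[s, t]) f r + \int[mu]_(r in `[s, t]) g r.
Proof. by move=> bf bg; rewrite RintegralD //; exact: bounded_measurable_integrable. Qed.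

Lemma integral_segmentB s t f g : bounded_measurable s t f ->
  bounded_measurable s t g ->
  \int[mu]_(r in `[s, t]) (f r - g r) =
  \int[mu]_(r in `[s, t]) f r - \int[mu]_(r in `[s, t]) g r.
Proof. by move=> bf bg; rewrite RintegralB //; exact: bounded_measurable_integrable. Qed.

Lemma integral_segmentZ s t r f : bounded_measurable s t f ->
  \int[mu]_(x in `[s, t]) (r * f x) = r * \int[mu]_(x in `[s, t]) f x.
Proof. by move=> bf; rewrite RintegralZl //; exact: bounded_measurable_integrable. Qed.

Lemma normr_integral_segment s t f M : s <= t -> bounded_measurable s t f ->
  (forall r, s <= r <= t -> `|f r| <= M) ->
  `|\int[mu]_(r in `[s, t]) f r| <= M * (t - s).
Proof.
move=> st bf fM; rewrite ler_norml; apply/andP; split.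
  rewrite -mulNr -integral_segment_cst //; apply: ler_integral_segment => //.
    exact: bounded_measurable_cst.
  by move=> r /fM; rewrite ler_norml => /andP[].
rewrite -integral_segment_cst //; apply: ler_integral_segment => //.
  exact: bounded_measurable_cst.
by move=> r /fM; rewrite ler_norml => /andP[].
Qed.

(** Only [f] carries a bound: [g] will be an integrand built from the given control, which obeys its
    constraint merely almost everywhere. *)
Lemma ae_eq_integral_segment a b f g s t : a <= s -> t <= b ->
  bounded_measurable a b f -> measurable_fun `[a, b]%classic g ->
  {ae mu, forall r, r \in `[a, b] -> f r = g r} ->
  \int[mu]_(r in `[s, t]) f r = \int[mu]_(r in `[s, t]) g r.
Proof.
move=> as_ tb bf mg fg.
have sub : (`[s, t] `<=` `[a, b])%classic.
  move=> x /=; rewrite !in_itv /= => /andP[sx xt].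
  by rewrite (le_trans as_ sx) (le_trans xt tb).
congr fine; apply: ae_eq_integral => //.
- by apply/measurable_EFinP; apply: measurable_funS sub bf.1.
- by apply/measurable_EFinP; apply: measurable_funS sub mg.
- by apply: ae_imply fg => r fg rst; rewrite /= fg //; exact: sub.
Qed.

Lemma ae0_segment f a b : bounded_measurable a b f ->
  (forall t, a <= t <= b -> 0 <= f t) ->
  \int[mu]_(t in `[a, b]) f t <= 0 ->
  {ae mu, forall t, t \in `[a, b] -> f t = 0}.
Proof.
move=> bf f0 int0.
have itf := bounded_measurable_integrable bf.
have abs : (\int[mu]_(x in `[a, b]) `|(EFin \o f) x| = 0)%E.
  rewrite (_ : (\int[mu]_(x in `[a, b]) `|(EFin \o f) x| = \int[mu]_(x in `[a, b]) (f x)%:E)%E).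
    rewrite -[LHS]fineK; last exact: integrable_fin_num.
    congr EFin; apply/eqP; rewrite eq_le; apply/andP; split; first exact: int0.
    by apply: fine_ge0; apply: integral_ge0 => x /=; rewrite in_itv /= lee_fin; exact: f0.
  by apply: eq_integral => x; rewrite inE /= in_itv /= => abx; rewrite ger0_norm ?f0.
have mf : measurable_fun `[a, b]%classic (EFin \o f) by apply/measurable_EFinP; exact: bf.1.
move: (ae_eq_integral_abs mu (measurable_itv `[a, b]) mf) => /= /iffLR /(_ abs).
by apply: ae_imply => t h /h [].
Qed.

End BoundedMeasurable.

(** * Calculus of primitives: linearity, product rule, exponential *)

Section Primitives.
Context {R : realType}.
Local Notation mu := (@lebesgue_measure R).
Implicit Types (a b s t r M K : R) (f g F G P : R -> R).

(* Cutting [a, b] into n equal pieces bounds |P b - P a| by K (b - a)^2 / n. *)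
Lemma quadratic_increments_cst a b K P : a <= b ->
  (forall s t, a <= s -> s <= t -> t <= b -> `|P t - P s| <= K * (t - s) ^+ 2) ->
  P b = P a.
Proof.
move=> ab quad.
have step (n : nat) : `|P b - P a| <= K * (b - a) ^+ 2 / n.+1%:R.
  have n0 : (0 : R) < n.+1%:R by rewrite ltr0n.
  pose h := (b - a) / n.+1%:R.
  have h0 : 0 <= h by rewrite divr_ge0 ?subr_ge0 // ltW.
  have hn : a + n.+1%:R * h = b by rewrite /h mulrCA divff ?gt_eqF // mulr1 addrC subrK.
  have ind (k : nat) : (k <= n.+1)%N ->
      `|P (a + k%:R * h) - P a| <= k%:R * (K * h ^+ 2).
    elim: k => [|k IH] kn; first by rewrite !mul0r addr0 subrr normr0.
    have Hk := IH (ltnW kn).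
    have := quad (a + k%:R * h) (a + k.+1%:R * h).
    have -> : a + k.+1%:R * h - (a + k%:R * h) = h by rewrite -natr1; ring.
    have -> : k.+1%:R * (K * h ^+ 2) = K * h ^+ 2 + k%:R * (K * h ^+ 2) :> R.
      by rewrite -natr1; ring.
    move=> Q; rewrite -(subrK (P (a + k%:R * h)) (P (a + k.+1%:R * h))) -addrA.
    apply: (le_trans (ler_normD _ _)); apply: lerD Hk; apply: Q.
    - by rewrite lerDl mulr_ge0.
    - by rewrite lerD2l ler_wpM2r // ler_nat.
    - by rewrite -hn lerD2l ler_wpM2r // ler_nat.
  have := ind n.+1 (leqnn _); rewrite hn => /le_trans; apply.
  rewrite le_eqVlt; apply/orP; left; apply/eqP; rewrite /h; field.
  by rewrite gt_eqF.
apply/eqP; rewrite -subr_eq0 -normr_le0 leNgt; apply/negP => pos.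
set C := K * (b - a) ^+ 2 in step.
have := step (Num.bound (C / `|P b - P a|)).
rewrite ler_pdivlMr ?ltr0n // => le1.
have C0 : 0 <= C by have := step 0%N; rewrite divr1; apply: le_trans.
have := archi_boundP (divr_ge0 C0 (ltW pos)); rewrite ltr_pdivrMr // => lt1.
have : (Num.bound (C / `|P b - P a|)).+1%:R = (Num.bound (C / `|P b - P a|))%:R + 1 :> R by rewrite natr1.
move=> E; rewrite E in le1; nra.
Qed.

Lemma bounded_measurable_ext a b f g : (forall t, a <= t <= b -> f t = g t) ->
  bounded_measurable a b f -> bounded_measurable a b g.
Proof.
move=> fg [mf [M fM]]; split.
  by apply: eq_measurable_fun mf => t; rewrite inE /= in_itv /=; exact: fg.
by exists M => t abt; rewrite -fg ?fM.
Qed.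

Lemma primitive_on_ext a b f F g G : (forall t, a <= t <= b -> f t = g t) ->
  (forall t, a <= t <= b -> F t = G t) ->
  primitive_on a b f F -> primitive_on a b g G.
Proof.
move=> fg FG [bf prF]; split; first exact: bounded_measurable_ext bf.
move=> s t as_ st tb; rewrite -!FG ?prF //; last 2 first.
- by rewrite as_ (le_trans st).
- by rewrite tb (le_trans as_).
apply: eq_Rintegral => r; rewrite inE /= in_itv /= => /andP[sr rt].
by apply: fg; rewrite (le_trans as_ sr) (le_trans rt tb).
Qed.

Lemma primitive_onS a b s t f F : a <= s -> t <= b ->
  primitive_on a b f F -> primitive_on s t f F.
Proof.
move=> as_ tb [bf prF]; split; first exact: bounded_measurableS bf.
by move=> s' t' ss' st' tt'; rewrite prF // ?(le_trans as_) // (le_trans tt').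
Qed.

Lemma primitive_on_integral a b k f : bounded_measurable a b f ->
  primitive_on a b f (fun t => k + \int[mu]_(r in `[a, t]) f r).
Proof.
move=> bf; split => // s t as_ st tb.
have bt : bounded_measurable a t f by apply: bounded_measurableS bf.
by rewrite (integral_segment_split bt as_ st); ring.
Qed.

Lemma primitive_on_cst a b k : primitive_on a b (fun=> 0) (fun=> k).
Proof.
split; first exact: bounded_measurable_cst.
by move=> s t _ st _; rewrite integral_segment_cst // mul0r subrr.
Qed.

Lemma primitive_onD a b f F g G : primitive_on a b f F -> primitive_on a b g G ->
  primitive_on a b (fun t => f t + g t) (fun t => F t + G t).
Proof.
move=> [bf prF] [bg prG]; split; first exact: bounded_measurableD.
move=> s t as_ st tb.
rewrite integral_segmentD; [|exact: bounded_measurableS bf|exact: bounded_measurableS bg].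
by rewrite -prF // -prG //; ring.
Qed.

Lemma primitive_onZ a b k f F : primitive_on a b f F ->
  primitive_on a b (fun t => k * f t) (fun t => k * F t).
Proof.
move=> [bf prF]; split; first exact: bounded_measurableZ.
move=> s t as_ st tb.
rewrite integral_segmentZ; last exact: bounded_measurableS bf.
by rewrite -prF //; ring.
Qed.

Lemma primitive_onB a b f F g G : primitive_on a b f F -> primitive_on a b g G ->
  primitive_on a b (fun t => f t - g t) (fun t => F t - G t).
Proof.
move=> pF pG; have := primitive_onD pF (primitive_onZ (-1) pG).
by apply: primitive_on_ext => t _; ring.
Qed.

Lemma primitive_on_lipschitz a b f F M : primitive_on a b f F ->
  (forall t, a <= t <= b -> `|f t| <= M) ->
  forall s t, a <= s <= b -> a <= t <= b -> `|F t - F s| <= M * `|t - s|.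
Proof.
move=> [bf prF] fM.
have aux s t : a <= s -> s <= t -> t <= b -> `|F t - F s| <= M * (t - s).
  move=> as_ st tb; rewrite prF //; apply: normr_integral_segment => //.
    exact: bounded_measurableS bf.
  by move=> r /andP[sr rt]; rewrite fM // (le_trans as_) // (le_trans rt).
move=> s t /andP[as_ sb] /andP[at_ tb].
have [st|/ltW ts] := leP s t; first by rewrite (ger0_norm (_ : 0 <= t - s)) ?subr_ge0 // aux.
by rewrite distrC (distrC t) (ger0_norm (_ : 0 <= s - t)) ?subr_ge0 // aux.
Qed.

Lemma lipschitz_within_continuous a b F M :
  (forall s t, a <= s <= b -> a <= t <= b -> `|F t - F s| <= M * `|t - s|) ->
  {within `[a, b]%classic, continuous F}%classic.
Proof.
move=> lip; apply/subspace_continuousP => s /= ; rewrite in_itv /= => abs.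
apply/cvgrPdist_lt => e e0; near=> t.
have abt : a <= t <= b.
  have : t \in `[a, b] by near: t; apply: withinT.
  by rewrite in_itv.
have M1 : 0 < `|M| + 1 by rewrite ltr_pwDr.
apply: (@le_lt_trans _ _ ((`|M| + 1) * `|s - t|)).
  apply: (le_trans (lip _ _ abt abs)); rewrite ler_wpM2r //.
  by rewrite (le_trans (ler_norm M)) // lerDl.
rewrite mulrC -ltr_pdivlMr //; near: t; apply: cvg_within.
have d0 : 0 < e / (`|M| + 1) by rewrite divr_gt0.
exact: (@nbhsx_ballx _ _ s _ d0).
Unshelve. all: by end_near. Qed.

Lemma within_continuous_bounded_measurable a b F :
  {within `[a, b]%classic, continuous F}%classic -> bounded_measurable a b F.
Proof.
move=> cF; split.
  by apply: subspace_continuous_measurable_fun => //; exact: measurable_itv.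
have cpt : compact (`[a, b]%classic : set R) by exact: segment_compact.
have /compact_bounded[M [_ Mrt]] := continuous_compact cF cpt.
exists (M + 1) => t abt; apply: Mrt; first by rewrite ltrDl.
by exists t => //=; rewrite in_itv.
Qed.

Lemma primitive_on_continuous a b f F : primitive_on a b f F ->
  {within `[a, b]%classic, continuous F}%classic.
Proof.
move=> pF; have [M fM] := pF.1.2.
exact: lipschitz_within_continuous (primitive_on_lipschitz pF fM).
Qed.

Lemma primitive_on_bounded_measurable a b f F : primitive_on a b f F ->
  bounded_measurable a b F.
Proof. by move=> /primitive_on_continuous; exact: within_continuous_bounded_measurable. Qed.

(** The error of [F] against the integral of [f] is itself the increment of a function, so a
    quadratic bound forces it to vanish. The product and exponential rules reduce to such a one-step
    estimate. *)
Lemma primitive_on_quadratic a b f F K : bounded_measurable a b f ->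
  (forall s t, a <= s -> s <= t -> t <= b ->
    `|F t - F s - \int[mu]_(r in `[s, t]) f r| <= K * (t - s) ^+ 2) ->
  primitive_on a b f F.
Proof.
move=> bf quad; split => // s t as_ st tb.
have bst : bounded_measurable s t f by apply: bounded_measurableS bf.
pose P r := F r - \int[mu]_(x in `[s, r]) f x.
have : P t = P s.
  apply: (@quadratic_increments_cst s t K) => // s' t' ss' st' tt'.
  have -> : P t' - P s' = F t' - F s' - \int[mu]_(r in `[s', t']) f r.
    rewrite /P (@integral_segment_split _ s t' s') //; first by ring.
    exact: bounded_measurableS bst.
  by apply: quad => //; [exact: le_trans ss'|exact: le_trans tb].
rewrite /P set_itv1 Rintegral_set1 subr0 => <-; ring.
Qed.

Lemma primitive_onM a b f F g G : primitive_on a b f F -> primitive_on a b g G ->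
  primitive_on a b (fun t => f t * G t + F t * g t) (fun t => F t * G t).
Proof.
move=> pF pG.
have [bf prF] := pF; have [bg prG] := pG.
have bF := primitive_on_bounded_measurable pF.
have bG := primitive_on_bounded_measurable pG.
have [M fM] := bf.2; have [K gK] := bg.2.
have lF := primitive_on_lipschitz pF fM; have lG := primitive_on_lipschitz pG gK.
apply: (@primitive_on_quadratic _ _ _ _ (2 * M * K)).
  by apply: bounded_measurableD; apply: bounded_measurableM.
move=> s t as_ st tb.
have sub h : bounded_measurable a b h -> bounded_measurable s t h.
  exact: bounded_measurableS.
(* Splitting F t G t - F s G s as G t (F t - F s) + F s (G t - G s) makes the error exactly the
   integral of [h]. Each of its two terms is at most M K (t - s), whence the constant 2 M K. *)
pose h r := f r * (G t - G r) + (F s - F r) * g r.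
have bh : bounded_measurable s t h.
  apply: bounded_measurableD; apply: bounded_measurableM;
    do ?[exact: sub]; apply: bounded_measurableB; do ?[exact: sub];
    exact: bounded_measurable_cst.
have -> : F t * G t - F s * G s - \int[mu]_(r in `[s, t]) (f r * G r + F r * g r)
   = \int[mu]_(r in `[s, t]) h r.
  have -> : \int[mu]_(r in `[s, t]) h r = \int[mu]_(r in `[s, t])
      (G t * f r + F s * g r - (f r * G r + F r * g r)).
    by apply: eq_Rintegral => r _; rewrite /h; ring.
  rewrite integral_segmentB; last 2 first.
  - by apply: bounded_measurableD; apply: bounded_measurableZ; apply: sub.
  - by apply: bounded_measurableD; apply: bounded_measurableM; apply: sub.
  rewrite [X in _ = X - _]integral_segmentD; last 2 first.
  - by apply: bounded_measurableZ; apply: sub.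
  - by apply: bounded_measurableZ; apply: sub.
  rewrite !integral_segmentZ; [|exact: sub|exact: sub].
  by rewrite -prF // -prG //; ring.
rewrite (_ : 2 * M * K * (t - s) ^+ 2 = (2 * M * K * (t - s)) * (t - s)); last by ring.
apply: normr_integral_segment => // r /andP[sr rt].
have abr : a <= r <= b by rewrite (le_trans as_) // (le_trans rt).
have abs : a <= s <= b by rewrite as_ (le_trans st).
have abt : a <= t <= b by rewrite tb (le_trans as_).
rewrite /h; apply: (le_trans (ler_normD _ _)); rewrite !normrM.
have M0 : 0 <= M by apply: le_trans (fM _ abr).
have K0 : 0 <= K by apply: le_trans (gK _ abr).
have H1 : `|G t - G r| <= K * (t - s).
  apply: (le_trans (lG _ _ abr abt)); rewrite ger0_norm ?subr_ge0 //.
  by rewrite ler_wpM2l // lerD2l lerN2.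
have H2 : `|F s - F r| <= M * (t - s).
  apply: (le_trans (lF _ _ abr abs)); rewrite distrC ger0_norm ?subr_ge0 //.
  by rewrite ler_wpM2l // lerD2r.
have := ler_pM (normr_ge0 _) (normr_ge0 _) (fM _ abr) H1.
have := ler_pM (normr_ge0 _) (normr_ge0 _) H2 (gK _ abr).
by move=> h1 h2; nra.
Qed.

Lemma expR_tangent (x y : R) : expR x + expR x * (y - x) <= expR y.
Proof.
have := expR_ge1Dx (y - x); rewrite expRB.
rewrite ler_pdivlMr ?expR_gt0 //; lra.
Qed.

Lemma expR_lipschitz (B x y : R) : x <= B -> y <= B ->
  `|expR y - expR x| <= expR B * `|y - x|.
Proof.
wlog xy : x y / x <= y.
  move=> H xB yB; have [xy|/ltW yx] := leP x y; first exact: H.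
  by rewrite distrC (distrC y); exact: H.
move=> xB yB; have := expR_tangent y x; have e1 : expR x <= expR y by rewrite ler_expR.
have : expR y <= expR B by rewrite ler_expR.
rewrite !ger0_norm ?subr_ge0 //; nra.
Qed.

(** Convexity suffices: the tangent at [x] makes the remainder nonnegative, and the tangent at [y]
    bounds it by (expR y - expR x) (y - x). *)
Lemma expR_taylor1 (B x y : R) : x <= B -> y <= B ->
  `|expR y - expR x - expR x * (y - x)| <= expR B * (y - x) ^+ 2.
Proof.
move=> xB yB; rewrite ger0_norm; last by have := expR_tangent x y; lra.
have : (expR y - expR x) * (y - x) <= expR B * (y - x) ^+ 2.
  rewrite (le_trans (ler_norm _)) // normrM -(real_normK (num_real (y - x))) expr2 mulrA.
  by rewrite ler_wpM2r // expR_lipschitz.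
have := expR_tangent y x; lra.
Qed.

Lemma primitive_on_expR a b f F : primitive_on a b f F ->
  primitive_on a b (fun t => f t * expR (F t)) (fun t => expR (F t)).
Proof.
move=> pF; have [bf prF] := pF.
have bF := primitive_on_bounded_measurable pF.
have [M fM] := bf.2; have [B FB] := bF.2.
have lF := primitive_on_lipschitz pF fM.
have FB' t : a <= t <= b -> F t <= B by move=> /FB; exact: le_trans (ler_norm _).
have bE : bounded_measurable a b (fun t => expR (F t)).
  apply: within_continuous_bounded_measurable.
  apply: (@lipschitz_within_continuous _ _ _ (expR B * M)) => s t abs abt.
  apply: (le_trans (expR_lipschitz (FB' _ abs) (FB' _ abt))).
  by rewrite -mulrA ler_wpM2l ?expR_ge0 // lF.
(* One expR B M^2 pays for the Taylor remainder of the exponential at [F s], the other for freezing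
   [expR (F r)] at [r = s] under the integral. *)
apply: (@primitive_on_quadratic _ _ _ _ (2 * expR B * M ^+ 2)).
  exact: bounded_measurableM.
move=> s t as_ st tb.
have sub h : bounded_measurable a b h -> bounded_measurable s t h.
  exact: bounded_measurableS.
have abs : a <= s <= b by rewrite as_ (le_trans st).
have abt : a <= t <= b by rewrite tb (le_trans as_).
have M0 : 0 <= M by apply: le_trans (fM _ abs).
pose h r := f r * (expR (F s) - expR (F r)).
have bh : bounded_measurable s t h.
  apply: bounded_measurableM; first exact: sub.
  apply: bounded_measurableB; [exact: bounded_measurable_cst|exact: sub].
have -> : expR (F t) - expR (F s) - \int[mu]_(r in `[s, t]) (f r * expR (F r))
   = (expR (F t) - expR (F s) - expR (F s) * (F t - F s)) + \int[mu]_(r in `[s, t]) h r.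
  have -> : \int[mu]_(r in `[s, t]) h r = \int[mu]_(r in `[s, t])
      (expR (F s) * f r - f r * expR (F r)).
    by apply: eq_Rintegral => r _; rewrite /h; ring.
  rewrite integral_segmentB; last 2 first.
  - by apply: bounded_measurableZ; apply: sub.
  - by apply: bounded_measurableM; apply: sub.
  rewrite integral_segmentZ; last exact: sub.
  by rewrite -prF //; ring.
apply: (le_trans (ler_normD _ _)).
rewrite (_ : 2 * expR B * M ^+ 2 * (t - s) ^+ 2 =
  expR B * (M * (t - s)) ^+ 2 + (expR B * M ^+ 2 * (t - s)) * (t - s)); last by ring.
apply: lerD.
  apply: (le_trans (expR_taylor1 (FB' _ abs) (FB' _ abt))).
  rewrite ler_wpM2l ?expR_ge0 // -(real_normK (num_real (F t - F s))).
  rewrite lerXn2r ?nnegrE ?mulr_ge0 ?subr_ge0 //.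
  by have := lF _ _ abs abt; rewrite (ger0_norm (_ : 0 <= t - s)) ?subr_ge0.
apply: normr_integral_segment => // r /andP[sr rt].
have abr : a <= r <= b by rewrite (le_trans as_) // (le_trans rt).
rewrite /h normrM.
have H1 : `|expR (F s) - expR (F r)| <= expR B * (M * (t - s)).
  apply: (le_trans (expR_lipschitz (FB' _ abr) (FB' _ abs))).
  rewrite ler_wpM2l ?expR_ge0 //; apply: (le_trans (lF _ _ abr abs)).
  by rewrite distrC ger0_norm ?subr_ge0 // ler_wpM2l // lerD2r.
have := ler_pM (normr_ge0 _) (normr_ge0 _) (fM _ abr) H1.
by have -> : M * (expR B * (M * (t - s))) = expR B * M ^+ 2 * (t - s) by ring.
Qed.

End Primitives.

(** * States, costates, and the first-order optimality condition *)

Section ControlSystem.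
Context {R : realType}.
Local Notation mu := (@lebesgue_measure R).
Implicit Types (T c alpha beta eps : R) (u v w x y q : R -> R).

Definition state_of T c (x0 : R) u x :=
  primitive_on 0 T (fun t => - u t * x t + c) x /\ x 0 = x0.

Definition costate_of T alpha u q :=
  primitive_on 0 T (fun t => u t * q t - alpha) q /\ q T = 0.

Lemma state_of_bounded_measurable T c (x0 : R) u x :
  state_of T c x0 u x -> bounded_measurable 0 T x.
Proof. by move=> [/primitive_on_bounded_measurable]. Qed.

(** Variation of constants: with U the integral of u, x = exp(-U) (x0 + c int_0^t exp U). *)
Lemma state_of_exists T c (x0 : R) u : 0 <= T -> bounded_measurable 0 T u ->
  exists x, state_of T c x0 u x.
Proof.
move=> T0 bu.
pose U t := 0 + \int[mu]_(r in `[0, t]) u r.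
have pU : primitive_on 0 T u U by exact: primitive_on_integral.
have U0 : U 0 = 0 by rewrite /U set_itv1 Rintegral_set1 addr0.
have pE := primitive_on_expR pU.
have bE := primitive_on_bounded_measurable pE.
pose A t := 0 + \int[mu]_(r in `[0, t]) expR (U r).
have pA : primitive_on 0 T (fun t => expR (U t)) A by exact: primitive_on_integral.
have A0 : A 0 = 0 by rewrite /A set_itv1 Rintegral_set1 addr0.
have pN := primitive_on_expR (primitive_onZ (-1) pU).
have pX := primitive_onM pN (primitive_onD (primitive_on_cst 0 T x0) (primitive_onZ c pA)).
exists (fun t => expR (-1 * U t) * (x0 + c * A t)); split.
  apply: primitive_on_ext pX => // t _.
  have E : expR (-1 * U t) * expR (U t) = 1.
    by rewrite -expRD mulN1r addNr expR0.
  rewrite (_ : expR (-1 * U t) * (0 + c * expR (U t)) = c * (expR (-1 * U t) * expR (U t))); last by ring.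
  by rewrite E; ring.
by rewrite U0 A0 !mulr0 expR0 addr0 mul1r.
Qed.

(** The explicit solution q(t) = alpha exp(U(t)) int_t^T exp(-U) shows its sign at once; the sign is
    needed later for AM-GM. *)
Lemma costate_of_exists T alpha u : 0 <= T -> 0 <= alpha -> bounded_measurable 0 T u ->
  exists q, costate_of T alpha u q /\ forall t, 0 <= t <= T -> 0 <= q t.
Proof.
move=> T0 al0 bu.
pose U t := 0 + \int[mu]_(r in `[0, t]) u r.
have pU : primitive_on 0 T u U by exact: primitive_on_integral.
have pN := primitive_on_expR (primitive_onZ (-1) pU).
have bN := primitive_on_bounded_measurable pN.
pose A t := 0 + \int[mu]_(r in `[0, t]) expR (-1 * U r).
have pA : primitive_on 0 T (fun t => expR (-1 * U t)) A by exact: primitive_on_integral.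
have pX := primitive_onM (primitive_on_expR pU)
  (primitive_onD (primitive_on_cst 0 T (alpha * A T)) (primitive_onZ (- alpha) pA)).
exists (fun t => expR (U t) * (alpha * A T + - alpha * A t)); split; first split.
- apply: primitive_on_ext pX => // t _.
  have E : expR (U t) * expR (-1 * U t) = 1.
    by rewrite -expRD mulN1r subrr expR0.
  rewrite (_ : expR (U t) * (0 + - alpha * expR (-1 * U t)) = - alpha * (expR (U t) * expR (-1 * U t))); last by ring.
  by rewrite E; ring.
- by rewrite mulNr subrr mulr0.
- move=> t /andP[t0 tT]; apply: mulr_ge0; first exact: expR_ge0.
  rewrite mulNr -mulrBr mulr_ge0 // (pA.2 _ _ t0 tT) //.
  by apply: Rintegral_ge0 => r _; exact: expR_ge0.
Qed.

(** The integrating factor exp(U) turns the equation into (exp(U) x)' = c exp(U) >= 0. This treats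
    an arbitrary solution, without appeal to uniqueness. *)
Lemma state_of_ge0 T c (x0 : R) u x : 0 <= c -> 0 <= x0 -> bounded_measurable 0 T u ->
  state_of T c x0 u x -> forall t, 0 <= t <= T -> 0 <= x t.
Proof.
move=> c0 x00 bu [px xE] t /andP[t0 tT].
pose U t := 0 + \int[mu]_(r in `[0, t]) u r.
have pU : primitive_on 0 T u U by exact: primitive_on_integral.
have U0 : U 0 = 0 by rewrite /U set_itv1 Rintegral_set1 addr0.
have pX := primitive_onM (primitive_on_expR pU) px.
have := pX.2 _ _ (lexx 0) t0 tT.
have : 0 <= \int[mu]_(r in `[0, t]) (u r * expR (U r) * x r + expR (U r) * (- u r * x r + c)).
  apply: Rintegral_ge0 => r _.
  rewrite (_ : _ + _ = expR (U r) * c); last by ring.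
  by rewrite mulr_ge0 ?expR_ge0.
move=> + E; rewrite -E U0 expR0 mul1r xE => H.
by rewrite -(pmulr_rge0 _ (expR_gt0 (U t))); lra.
Qed.

Lemma state_of_le T c (x0 : R) u x : 0 <= c -> 0 <= x0 -> bounded_measurable 0 T u ->
  (forall t, 0 <= t <= T -> 0 <= u t) ->
  state_of T c x0 u x -> forall t, 0 <= t <= T -> x t <= x0 + c * T.
Proof.
move=> c0 x00 bu u0 sx t /andP[t0 tT].
have x_ge0 := state_of_ge0 c0 x00 bu sx.
have [px xE] := sx.
have le1 : \int[mu]_(r in `[0, t]) (- u r * x r + c) <= \int[mu]_(r in `[0, t]) c.
  apply: ler_integral_segment.
  - exact: bounded_measurableS px.1.
  - exact: bounded_measurable_cst.
  - move=> r /andP[r0 rt]; have r0T : 0 <= r <= T by rewrite r0 (le_trans rt).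
    by have := u0 _ r0T; have := x_ge0 _ r0T; nra.
have := px.2 _ _ (lexx 0) t0 tT; rewrite xE.
rewrite integral_segment_cst // in le1.
have : c * t <= c * T by rewrite ler_wpM2l.
lra.
Qed.

(* With d := y - x, the function exp(int u) d has derivative exp(int u) (u - v) y. *)
Lemma state_of_perturb T c (x0 : R) (u1 : R) eps u v x y : 0 <= T -> 0 <= c -> 0 <= x0 ->
  0 <= eps -> bounded_measurable 0 T u -> bounded_measurable 0 T v ->
  (forall t, 0 <= t <= T -> 0 <= u t <= u1) ->
  (forall t, 0 <= t <= T -> 0 <= v t) ->
  (forall t, 0 <= t <= T -> `|u t - v t| <= eps) ->
  state_of T c x0 u x -> state_of T c x0 v y ->
  forall t, 0 <= t <= T -> `|y t - x t| <= expR (u1 * T) * (x0 + c * T) * T * eps.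
Proof.
move=> T0 c0 x00 e0 bu bv u01 v0 uv sx sy t /andP[t0 tT].
pose U t := 0 + \int[mu]_(r in `[0, t]) u r.
have pU : primitive_on 0 T u U by exact: primitive_on_integral.
have U0 : U 0 = 0 by rewrite /U set_itv1 Rintegral_set1 addr0.
have Ub r : 0 <= r <= T -> 0 <= U r <= u1 * T.
  move=> /andP[r0 rT].
  have u10 : 0 <= u1 by have /andP[] := u01 0 (introT andP (conj (lexx 0) T0)); exact: le_trans.
  have := pU.2 _ _ (lexx 0) r0 rT; rewrite U0 subr0 => ->; apply/andP; split.
    by apply: Rintegral_ge0 => z; rewrite /= in_itv /= => /andP[z0 zr]; have /andP[] := u01 z (introT andP (conj z0 (le_trans zr rT))).
  apply: (@le_trans _ _ (\int[mu]_(z in `[0, r]) u1)).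
    apply: ler_integral_segment.
    - exact: bounded_measurableS bu.
    - exact: bounded_measurable_cst.
    - by move=> z /andP[z0 zr]; have /andP[] := u01 z (introT andP (conj z0 (le_trans zr rT))).
  by rewrite integral_segment_cst // subr0 ler_wpM2l.
have pE := primitive_on_expR pU.
have bE := primitive_on_bounded_measurable pE.
have bx := state_of_bounded_measurable sx.
have by_ := state_of_bounded_measurable sy.
have y_ge0 := state_of_ge0 c0 x00 bv sy.
have y_le := state_of_le c0 x00 bv v0 sy.
have [px xE] := sx; have [py yE] := sy.
have pD := primitive_onM pE (primitive_onB py px).
have {}pD : primitive_on 0 T (fun r => expR (U r) * ((u r - v r) * y r))
    (fun r => expR (U r) * (y r - x r)).
  by apply: primitive_on_ext pD => // r _; ring.
have := pD.2 _ _ (lexx 0) t0 tT; rewrite xE yE subrr mulr0 subr0 => E.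
have t0T : 0 <= t <= T by rewrite t0.
have Et1 : 1 <= expR (U t) by rewrite -expR0 ler_expR; have /andP[] := Ub _ t0T.
apply: (@le_trans _ _ (expR (U t) * `|y t - x t|)).
  by rewrite ler_peMl.
rewrite -{1}(ger0_norm (expR_ge0 (U t))) -normrM E.
apply: (@le_trans _ _ (expR (u1 * T) * (eps * (x0 + c * T)) * (t - 0))).
  apply: normr_integral_segment => //; first exact: bounded_measurableS pD.1.
  move=> r /andP[r0 rt]; have r0T : 0 <= r <= T by rewrite r0 (le_trans rt).
  rewrite !normrM ger0_norm ?expR_ge0 // (ger0_norm (y_ge0 _ r0T)).
  apply: ler_pM; rewrite ?expR_ge0 ?mulr_ge0 ?y_ge0 //.
    by rewrite ler_expR; have /andP[] := Ub _ r0T.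
  by apply: ler_pM; rewrite ?y_ge0 ?y_le ?uv.
rewrite subr0 (_ : _ * T * eps = expR (u1 * T) * (eps * (x0 + c * T)) * T); last by ring.
by rewrite ler_wpM2l // !mulr_ge0 ?expR_ge0 // addr_ge0 // mulr_ge0.
Qed.

(* Integrate (q (y - x))' = - alpha (y - x) - q y (v - u); the boundary terms vanish. *)
Lemma cost_difference T c (x0 : R) alpha beta u v x y q : 0 <= T ->
  bounded_measurable 0 T u -> bounded_measurable 0 T v ->
  state_of T c x0 u x -> state_of T c x0 v y -> costate_of T alpha u q ->
  \int[mu]_(t in `[0, T]) (alpha * y t + beta * v t) -
  \int[mu]_(t in `[0, T]) (alpha * x t + beta * u t) =
  \int[mu]_(t in `[0, T]) ((beta - q t * y t) * (v t - u t)).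
Proof.
move=> T0 bu bv sx sy [pq qT].
have bx := state_of_bounded_measurable sx.
have by_ := state_of_bounded_measurable sy.
have bq := primitive_on_bounded_measurable pq.
have [px xE] := sx; have [py yE] := sy.
have pD := primitive_onM pq (primitive_onB py px).
have := pD.2 _ _ (lexx 0) T0 (lexx T).
rewrite qT xE yE mul0r subrr mulr0 subrr => /esym I0.
have bc (h : R -> R) k : bounded_measurable 0 T h -> bounded_measurable 0 T (fun t => k * h t).
  exact: bounded_measurableZ.
rewrite -integral_segmentB; do ?by apply: bounded_measurableD; exact: bc.
rewrite -[LHS]addr0 -[X in _ + X]I0 -integral_segmentD; last 2 first.
- by apply: bounded_measurableB; apply: bounded_measurableD; exact: bc.
- exact: pD.1.
by apply: eq_Rintegral => t _; ring.
Qed.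

(** Real-valued optimality against competitors that satisfy the constraint at every point of the
    interval; [optimal_minimizes] links it to [optimal]. *)
Definition minimizes T c (x0 : R) alpha beta (u1 : R) u x :=
  forall v y, measurable_fun `[0, T]%classic v ->
    (forall t, 0 <= t <= T -> 0 <= v t <= u1) -> state_of T c x0 v y ->
    \int[mu]_(t in `[0, T]) (alpha * x t + beta * u t) <=
    \int[mu]_(t in `[0, T]) (alpha * y t + beta * v t).

Lemma bounded_measurable_control T (u1 : R) u : measurable_fun `[0, T]%classic u ->
  (forall t, 0 <= t <= T -> 0 <= u t <= u1) -> bounded_measurable 0 T u.
Proof.
move=> mu_ u01; split => //; exists u1 => t /u01 /andP[u0 uu1].
by rewrite ger0_norm.
Qed.

(** The set of controls is convex, so u + eps (w - u) is a competitor. Its cost excess is eps times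
    an integral that differs from the one claimed only by y - x = O(eps). *)
Lemma first_variation T c (x0 : R) alpha beta (u1 : R) u x q w : 0 < T -> 0 <= c -> 0 <= x0 ->
  measurable_fun `[0, T]%classic u -> (forall t, 0 <= t <= T -> 0 <= u t <= u1) ->
  measurable_fun `[0, T]%classic w -> (forall t, 0 <= t <= T -> 0 <= w t <= u1) ->
  state_of T c x0 u x -> costate_of T alpha u q ->
  minimizes T c x0 alpha beta u1 u x ->
  0 <= \int[mu]_(t in `[0, T]) ((beta - q t * x t) * (w t - u t)).
Proof.
move=> T0 c0 x00 mu_ u01 mw w01 sx sq opt.
have T0' := ltW T0.
have bu := bounded_measurable_control mu_ u01.
have bw := bounded_measurable_control mw w01.
have bx := state_of_bounded_measurable sx.
have bq := primitive_on_bounded_measurable sq.1.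
have [Q qQ] := bq.2.
have u10 : 0 <= u1 by have /andP[] := u01 0 (introT andP (conj (lexx 0) T0')); exact: le_trans.
have Q0 : 0 <= Q by apply: le_trans (qQ 0 _); rewrite ?lexx.
pose C := expR (u1 * T) * (x0 + c * T) * T.
have C0 : 0 <= C by rewrite !mulr_ge0 ?expR_ge0 // addr_ge0 // mulr_ge0.
set I := Rintegral _ _ _.
(* The factors bound, in turn, the costate, the change of state, [w - u], and the length of the
   interval. *)
have key eps : 0 < eps -> eps <= 1 -> - (Q * (C * (u1 * eps)) * u1 * T) <= I.
  move=> e0 e1.
  pose v t := u t + eps * (w t - u t).
  have bv : bounded_measurable 0 T v.
    by apply: bounded_measurableD => //; apply: bounded_measurableZ; apply: bounded_measurableB.
  have v01 t : 0 <= t <= T -> 0 <= v t <= u1.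
    move=> tT; have /andP[a1 a2] := u01 _ tT; have /andP[b1 b2] := w01 _ tT.
    by rewrite /v; apply/andP; split; nra.
  have [y sy] := state_of_exists c x0 T0' bv.
  have by_ := state_of_bounded_measurable sy.
  have wu t : 0 <= t <= T -> `|w t - u t| <= u1.
    move=> tT; have /andP[a1 a2] := u01 _ tT; have /andP[b1 b2] := w01 _ tT.
    by rewrite ler_norml; apply/andP; split; lra.
  have pert t : 0 <= t <= T -> `|y t - x t| <= C * (u1 * eps).
    apply: (state_of_perturb (v := v) (x := x) (y := y) T0' c0 x00 _ bu bv) => //.
    - by rewrite mulr_ge0 // ltW.
    - by move=> r /v01 /andP[].
    - move=> r rT; rewrite /v (_ : u r - _ = eps * - (w r - u r)); last by ring.
      by rewrite normrM normrN (gtr0_norm e0) mulrC ler_wpM2r ?wu //; exact: ltW.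
  have := opt v y bv.1 v01 sy.
  rewrite -subr_ge0 (cost_difference beta T0' bu bv sx sy sq).
  have -> : \int[mu]_(t in `[0, T]) ((beta - q t * y t) * (v t - u t)) =
     \int[mu]_(t in `[0, T]) (eps * ((beta - q t * y t) * (w t - u t))).
    by apply: eq_Rintegral => t _; rewrite /v; ring.
  have bwu : bounded_measurable 0 T (fun t => w t - u t) by exact: bounded_measurableB.
  have bS z : bounded_measurable 0 T z ->
      bounded_measurable 0 T (fun t => (beta - q t * z t) * (w t - u t)).
    move=> bz; apply: bounded_measurableM => //; apply: bounded_measurableB.
      exact: bounded_measurable_cst.
    exact: bounded_measurableM.
  rewrite integral_segmentZ; last exact: bS.
  rewrite pmulr_rge0 // => ge0.
  have bd : bounded_measurable 0 T (fun t => q t * (y t - x t) * (w t - u t)).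
    by apply: bounded_measurableM => //; apply: bounded_measurableM => //; apply: bounded_measurableB.
  have IE : I = \int[mu]_(t in `[0, T]) ((beta - q t * y t) * (w t - u t)) +
      \int[mu]_(t in `[0, T]) (q t * (y t - x t) * (w t - u t)).
    rewrite -integral_segmentD //; last exact: bS.
    by apply: eq_Rintegral => t _; ring.
  have : `|\int[mu]_(t in `[0, T]) (q t * (y t - x t) * (w t - u t))| <=
     Q * (C * (u1 * eps)) * u1 * (T - 0).
    apply: normr_integral_segment => // t tT; rewrite !normrM.
    by apply: ler_pM; rewrite ?mulr_ge0 ?wu //; apply: ler_pM; rewrite ?qQ ?pert.
  rewrite subr0 ler_norml => /andP[lb _].
  by rewrite IE; lra.
rewrite leNgt; apply/negP => I0.
pose D := Q * C * u1 * u1 * T.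
have D0 : 0 <= D by rewrite /D; do 4 (apply: mulr_ge0 => //).
have d0 : 0 < D + 1 - I by lra.
(* This makes both [eps <= 1] and [D * eps < - I], which contradicts [key]. *)
pose eps := - I / (2 * (D + 1 - I)).
have e0 : 0 < eps by rewrite divr_gt0 ?oppr_gt0 // mulr_gt0.
have eE : eps * (2 * (D + 1 - I)) = - I by rewrite /eps divfK // gt_eqF // mulr_gt0.
have e1 : eps <= 1 by nra.
have := key eps e0 e1.
rewrite (_ : Q * (C * (u1 * eps)) * u1 * T = D * eps); last by rewrite /D; ring.
nra.
Qed.

(* Testing the first variation against the bang-bang control makes a
   nonpositive integrand have a nonnegative integral. *)
Lemma minimum_principle T c (x0 : R) alpha beta (u1 : R) u x q : 0 < T -> 0 <= c -> 0 <= x0 ->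
  measurable_fun `[0, T]%classic u -> (forall t, 0 <= t <= T -> 0 <= u t <= u1) ->
  state_of T c x0 u x -> costate_of T alpha u q ->
  minimizes T c x0 alpha beta u1 u x ->
  {ae mu, forall t, t \in `[0, T] ->
    (beta < q t * x t -> u t = u1) /\ (q t * x t < beta -> u t = 0)}.
Proof.
move=> T0 c0 x00 mu_ u01 sx sq opt.
have bu := bounded_measurable_control mu_ u01.
have bx := state_of_bounded_measurable sx.
have bq := primitive_on_bounded_measurable sq.1.
have bS : bounded_measurable 0 T (fun t => q t * x t) by exact: bounded_measurableM.
have u10 : 0 <= u1.
  by have /andP[] := u01 0 (introT andP (conj (lexx 0) (ltW T0))); exact: le_trans.
pose w t := if beta < q t * x t then u1 else if q t * x t < beta then 0 else u t.
have mif (p : R -> bool) (g h : R -> R) : measurable_fun `[0, T]%classic p ->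
    measurable_fun `[0, T]%classic g -> measurable_fun `[0, T]%classic h ->
    measurable_fun `[0, T]%classic (fun t => if p t then g t else h t).
  move=> mp mg mh; apply: measurable_fun_if => //.
    by apply: (measurable_funS (measurable_itv _) _ mg) => // ? [].
  by apply: (measurable_funS (measurable_itv _) _ mh) => // ? [].
have mw : measurable_fun `[0, T]%classic w.
  apply: (mif _ (fun=> u1)); [|exact: measurable_cst|apply: (mif _ (fun=> 0));
    [|exact: measurable_cst|exact: mu_]].
    by apply: measurable_fun_ltr; [exact: measurable_cst|exact: bS.1].
  by apply: measurable_fun_ltr; [exact: bS.1|exact: measurable_cst].
have w01 t : 0 <= t <= T -> 0 <= w t <= u1.
  move=> tT; rewrite /w; case: ifPn => _; first by rewrite u10 lexx.
  by case: ifPn => _; [rewrite lexx|exact: u01].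
have bw := bounded_measurable_control mw w01.
have fv := first_variation T0 c0 x00 mu_ u01 mw w01 sx sq opt.
have bh : bounded_measurable 0 T (fun t => - ((beta - q t * x t) * (w t - u t))).
  apply: bounded_measurableN; apply: bounded_measurableM; last exact: bounded_measurableB.
  by apply: bounded_measurableB => //; exact: bounded_measurable_cst.
have := ae0_segment bh.
have h0 t : 0 <= t <= T -> 0 <= - ((beta - q t * x t) * (w t - u t)).
  move=> /u01 /andP[a1 a2]; rewrite /w; case: ltgtP => [S|S|S].
  - nra.
  - nra.
  - by rewrite subrr mulr0 oppr0.
move=> /(_ h0) H.
have : \int[mu]_(t in `[0, T]) - ((beta - q t * x t) * (w t - u t)) <= 0.
  have -> : \int[mu]_(t in `[0, T]) - ((beta - q t * x t) * (w t - u t)) =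
     \int[mu]_(t in `[0, T]) (-1 * ((beta - q t * x t) * (w t - u t))).
    by apply: eq_Rintegral => t _; rewrite mulN1r.
  rewrite integral_segmentZ; first by rewrite mulN1r oppr_le0.
  by apply: bounded_measurable_ext (bounded_measurableN bh) => t _; rewrite opprK.
move=> /H; apply: ae_imply => t ht tT; have := ht tT; rewrite /w.
case: ltgtP => [S|S|S] /eqP; rewrite oppr_eq0 mulf_eq0 !subr_eq0.
- by rewrite (lt_eqF S) (eq_sym u1) => /eqP ->; split.
- by rewrite (gt_eqF S) eq_sym => /eqP ->; split.
- by [].
Qed.

End ControlSystem.

(** * Barrier arguments for concave and convex arcs, and arcs on which a primitive is constant *)

Section Structure.
Context {R : realType}.
Local Notation mu := (@lebesgue_measure R).
Implicit Types (a b m s t M beta : R) (f g F D S : R -> R).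

(** The point is the supremum of the times with g >= 0; the Lipschitz bound keeps g from dropping
    below zero there. *)
Lemma exists_last_ge0 a m M g : a <= m ->
  (forall s t, a <= s <= m -> a <= t <= m -> `|g t - g s| <= M * `|t - s|) ->
  0 <= g a ->
  exists b, [/\ a <= b <= m, 0 <= g b & forall t, b < t <= m -> g t < 0].
Proof.
move=> am lip ga.
pose E : set R := [set t | a <= t <= m /\ 0 <= g t]%classic.
have Ea : E a by split => //; rewrite lexx.
have Eub : has_ubound E by exists m => t [/andP[]].
have Esup : has_sup E by split => //; exists a.
have ab : a <= sup E by exact: (ub_le_sup Eub).
have bm : sup E <= m by apply: ge_sup; [exists a|move=> t [/andP[]]].
exists (sup E); split; first by rewrite ab.
  rewrite leNgt; apply/negP => gb.
  have M1 : 0 < `|M| + 1 by rewrite ltr_pwDr.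
  (* Within this distance of the supremum the Lipschitz bound would keep [g] negative, although
     members of [E] come that close. The [+ 1] guards against a zero constant. *)
  have e0 : 0 < - g (sup E) / (`|M| + 1) by rewrite divr_gt0 // oppr_gt0.
  have [t [atm gt0] tb] := sup_adherent e0 Esup.
  have tle : t <= sup E by exact: (ub_le_sup Eub).
  have abm : a <= sup E <= m by rewrite ab.
  have := lip _ _ abm atm.
  rewrite (distrC t) (ger0_norm (_ : 0 <= sup E - t)) ?subr_ge0 // => H.
  have := ler_norm (g t - g (sup E)).
  have MM := ler_norm M.
  have lt1 : sup E - t < - g (sup E) / (`|M| + 1) by lra.
  rewrite ltr_pdivlMr // in lt1.
  have : 0 <= sup E - t by rewrite subr_ge0.
  nra.
move=> t /andP[bt tm]; rewrite ltNge; apply/negP => gt0.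
have Et : E t by split => //; rewrite tm (le_trans ab) // ltW.
by have := ub_le_sup Eub Et; rewrite leNgt bt.
Qed.

Lemma exists_first_ge0 m b M g : m <= b ->
  (forall s t, m <= s <= b -> m <= t <= b -> `|g t - g s| <= M * `|t - s|) ->
  0 <= g b ->
  exists a, [/\ m <= a <= b, 0 <= g a & forall t, m <= t < a -> g t < 0].
Proof.
move=> mb lip gb.
(* Time reversal turns a first time into a last one. *)
have [||| c [/andP[c1 c2] gc cE]] := @exists_last_ge0 (- b) (- m) M (fun t => g (- t)).
- by rewrite lerN2.
- move=> s t /andP[s1 s2] /andP[t1 t2].
  rewrite -(normrN (t - s)) (_ : - (t - s) = - t - - s); last by ring.
  by apply: lip; rewrite lerNr lerNl ?s1 ?s2 ?t1 ?t2.
- by rewrite opprK.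
exists (- c); split => //; first by rewrite lerNr lerNl c1 c2.
move=> t /andP[mt tc]; rewrite -(opprK t); apply: cE.
by rewrite ltrNr tc lerN2.
Qed.

Lemma ae_neq s : {ae mu, forall t, t != s}.
Proof.
exists [set s]%classic; split => //; first exact: lebesgue_measure_set1.
by move=> t /= /negP; rewrite negbK => /eqP.
Qed.

Lemma integral_ae_le0 s t f : s <= t -> bounded_measurable s t f ->
  {ae mu, forall r, r \in `]s, t[ -> f r <= 0} ->
  \int[mu]_(r in `[s, t]) f r <= 0.
Proof.
move=> st bf f0.
(* Truncating at 0 changes [f] only on a null set, endpoints included, and gives a sign valid
   everywhere. *)
have mg : measurable_fun `[s, t]%classic (fun r => Num.min (f r) 0).
  by apply: measurable_minr; [exact: bf.1|exact: measurable_cst].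
rewrite (ae_eq_integral_segment (lexx s) (lexx t) bf mg); last first.
  have neq := @ae_imply2 R _ _ (fun r => r != s /\ r != t)
    (fun _ rs rt => conj rs rt) (ae_neq s) (ae_neq t).
  apply: (ae_imply2 _ neq f0) => r [rs rt] f0r.
  rewrite in_itv /= => /andP[sr rt'].
  apply/esym/min_idPl/f0r.
  by rewrite in_itv /= !lt_neqAle sr rt' rt eq_sym rs.
rewrite -[leRHS](mul0r (t - s)) -integral_segment_cst //.
apply: ler_integral_segment.
- split => //; have [M fM] := bf.2; exists M => r /fM fr.
  by rewrite /Num.min; case: ifP => // _; rewrite normr0; apply: le_trans fr.
- exact: bounded_measurable_cst.
- by move=> r _; rewrite ge_min lexx orbT.
Qed.

Lemma exists_lt0_of_integral_lt0 s t f :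
  \int[mu]_(r in `[s, t]) f r < 0 -> exists2 r, s <= r <= t & f r < 0.
Proof.
move=> I0; apply: contrapT => H.
have : 0 <= \int[mu]_(r in `[s, t]) f r.
  apply: Rintegral_ge0 => r /=; rewrite in_itv /= => str.
  by rewrite leNgt; apply/negP => fr; apply: H; exists r.
by rewrite leNgt I0.
Qed.

(* A minimum of S below beta would lie inside an interval on which S < beta
   and S is concave. *)
Lemma concave_below_barrier a b beta S D f :
  primitive_on a b D S -> primitive_on a b f D ->
  {ae mu, forall t, t \in `]a, b[ -> S t < beta -> f t <= 0} ->
  beta <= S a -> beta <= S b -> forall t, a <= t <= b -> beta <= S t.
Proof.
move=> pS pD fle Sa Sb m /andP[am mb]; rewrite leNgt; apply/negP => Sm.
have [M DM] := pS.1.2.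
have lS := primitive_on_lipschitz pS DM.
have [|| a' [/andP[aa' am'] Sa' lt1]] := @exists_last_ge0 a m M (fun t => S t - beta) am.
- move=> s t /andP[s1 s2] /andP[t1 t2].
  rewrite (_ : S t - beta - _ = S t - S s); last by ring.
  by apply: lS; rewrite ?s1 ?t1 /= (le_trans _ mb).
- by rewrite subr_ge0.
have [|| b' [/andP[mb' bb'] Sb' lt2]] := @exists_first_ge0 m b M (fun t => S t - beta) mb.
- move=> s t /andP[s1 s2] /andP[t1 t2].
  rewrite (_ : S t - beta - _ = S t - S s); last by ring.
  by apply: lS; rewrite ?s2 ?t2 ?andbT (le_trans am).
- by rewrite subr_ge0.
(* Mean value argument: S falls on [a', m], so S' < 0 at some [r1]; it rises on [m, b'], so S' > 0
   at some later [r2]. But S' cannot increase between them, since S < beta inside. *)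
have [|r1 /andP[ar1 r1m] D1] := @exists_lt0_of_integral_lt0 a' m D.
  by rewrite -pS.2 //; lra.
have [|r2 /andP[mr2 r2b] D2] := @exists_lt0_of_integral_lt0 m b' (fun t => - D t).
  rewrite (_ : Rintegral _ _ _ = \int[mu]_(t in `[m, b']) (-1 * D t)); last first.
    by apply: eq_Rintegral => t _; rewrite mulN1r.
  rewrite integral_segmentZ; last exact: bounded_measurableS pS.1.
  by rewrite -pS.2 //; lra.
have r12 : r1 <= r2 by exact: le_trans mr2.
have := pD.2 r1 r2 (le_trans aa' ar1) r12 (le_trans r2b bb').
have : \int[mu]_(r in `[r1, r2]) f r <= 0.
  apply: integral_ae_le0 => //.
    by apply: bounded_measurableS pD.1; [exact: le_trans ar1|exact: le_trans bb'].
  apply: ae_imply fle => t ft; rewrite in_itv /= => /andP[rt1 rt2].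
  apply: ft; first by rewrite in_itv /= (le_lt_trans _ rt1) ?(lt_le_trans rt2) // ?(le_trans r2b) // (le_trans aa').
  have [tm|mt] := leP t m.
    by rewrite -subr_lt0; apply: lt1; rewrite tm (le_lt_trans ar1).
  by rewrite -subr_lt0; apply: lt2; rewrite (ltW mt) (lt_le_trans rt2).
by move=> ? ?; lra.
Qed.

Lemma convex_above_barrier a b beta S D f :
  primitive_on a b D S -> primitive_on a b f D ->
  {ae mu, forall t, t \in `]a, b[ -> beta < S t -> 0 <= f t} ->
  S a <= beta -> S b <= beta -> forall t, a <= t <= b -> S t <= beta.
Proof.
move=> pS pD fge Sa Sb t abt.
rewrite -lerN2 -(mulN1r (S t)).
apply: (concave_below_barrier (primitive_onZ (-1) pS) (primitive_onZ (-1) pD)) abt;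
  rewrite ?mulN1r ?lerN2 //.
apply: ae_imply fge => r H rab; rewrite !mulN1r ltrN2 oppr_le0; exact: H.
Qed.

(** By Lebesgue differentiation [f] is almost everywhere the derivative of its integral, which is
    locally constant here. *)
Lemma primitive_on_cst_ae a b k f F : primitive_on a b f F ->
  (forall t, a <= t < b -> F t = k) ->
  {ae mu, forall t, t \in `]a, b[ -> f t = 0}.
Proof.
move=> [bf prF] Fk.
have itf := bounded_measurable_integrable bf.
(* [f] is extended by zero because [FTC1] is applied with integrability on every segment [a, y],
   also beyond [b]. *)
have itfr : mu.-integrable setT (EFin \o (f \_ `[a, b]%classic)).
  by rewrite -restrict_EFin; apply/(integrable_mkcond _ _).1.
have itfy y : mu.-integrable `[a, y]%classic (EFin \o (f \_ `[a, b]%classic)).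
  by apply: integrableS itfr.
have locf : locally_integrable setT (f \_ `[a, b]%classic).
  by apply: integrable_locally => //; exact: measurable_itv.
have := @FTC1 R (f \_ `[a, b]%classic) (BLeft a) itfy locf.
apply: ae_imply => t H; rewrite in_itv /= => /andP[at_ tb].
have [] := H at_ => _; rewrite patchE mem_set /=; last by rewrite in_itv /= !ltW.
move=> <-; rewrite derive1E.
rewrite (@near_eq_derive _ _ _ _ (cst 0)) ?derive_cst //.
near=> y.
have ay : a <= y by apply: ltW; near: y; exact: lt_nbhsr.
have yb : y < b by near: y; exact: lt_nbhsl.
rewrite /cst -[RHS](subrr k) -{1}(Fk y) ?ay // -(Fk a) ?lexx ?(lt_trans at_) //.
rewrite prF // ?ltW //; apply: eq_Rintegral => z; rewrite inE /= in_itv /= => /andP[az zy].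
by rewrite patchE mem_set //= in_itv /= az (le_trans zy) ?ltW.
Unshelve. all: by end_near. Qed.

(* If a Lipschitz derivative were nonzero at s, S would move to first order right of s. *)
Lemma primitive_on_cst_derivative a b k M D S :
  primitive_on a b D S ->
  (forall s t, a <= s <= b -> a <= t <= b -> `|D t - D s| <= M * `|t - s|) ->
  (forall t, a <= t <= b -> S t = k) -> forall t, a <= t < b -> D t = 0.
Proof.
move=> pS lD Sk s /andP[as_ sb].
have asb : a <= s <= b by rewrite as_ ltW.
have M0 : 0 <= M.
  have := lD _ _ asb (introT andP (conj (le_trans as_ (ltW sb)) (lexx b))).
  move=> /(le_trans (normr_ge0 _)); rewrite pmulr_lge0 // normr_gt0 subr_eq0.
  by rewrite gt_eqF.
have key t : s < t -> t <= b -> `|D s| <= M * (t - s).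
  move=> st tb.
  have bD : bounded_measurable s t D by apply: bounded_measurableS pS.1.
  have bc : bounded_measurable s t (fun=> D s) by exact: bounded_measurable_cst.
  have : `|\int[mu]_(r in `[s, t]) (D r - D s)| <= (M * (t - s)) * (t - s).
    apply: normr_integral_segment; [exact: ltW|exact: bounded_measurableB|].
    move=> r /andP[sr rt].
    have arb : a <= r <= b by rewrite (le_trans as_) // (le_trans rt).
    apply: (le_trans (lD _ _ asb arb)); rewrite ger0_norm ?subr_ge0 //.
    by rewrite ler_wpM2l // lerD2r.
  rewrite integral_segmentB // -pS.2 ?(ltW st) // integral_segment_cst ?(ltW st) //.
  rewrite !Sk //; last by rewrite tb (le_trans as_) // ltW.
  rewrite subrr sub0r normrN normrM (gtr0_norm (_ : 0 < t - s)) ?subr_gt0 //.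
  by rewrite ler_pM2r // subr_gt0.
apply/eqP; rewrite -normr_le0 leNgt; apply/negP => Ds.
(* The first bound keeps [s + d] in the interval; the second makes [M * d] smaller than the norm of
   [D s], against [key]. *)
pose d := Num.min (b - s) (`|D s| / (2 * (M + 1))).
have d0 : 0 < d by rewrite lt_min subr_gt0 sb divr_gt0 // mulr_gt0 // ltr_wpDl.
have d1 : d <= b - s by rewrite ge_min lexx.
have d2 : d <= `|D s| / (2 * (M + 1)) by rewrite ge_min lexx orbT.
rewrite ler_pdivlMr in d2; last by rewrite mulr_gt0 // ltr_wpDl.
have := key (s + d); rewrite ltrDl => /(_ d0).
have -> : s + d - s = d by ring.
have : s + d <= b by lra.
move=> sd /(_ sd); nra.
Qed.

End Structure.

(** * The switching function S = q x and its derivatives *)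

Section SwitchingFunction.
Context {R : realType}.
Local Notation mu := (@lebesgue_measure R).
Implicit Types (T c alpha beta : R) (u x q : R -> R).

(** The terms u q x from the two equations cancel, so S' does not contain the control. It is thus a
    primitive itself, and S'' makes sense for a merely measurable [u]. *)
Lemma switching_derivative T c (x0 : R) alpha u x q :
  state_of T c x0 u x -> costate_of T alpha u q ->
  primitive_on 0 T (fun t => c * q t - alpha * x t) (fun t => q t * x t).
Proof.
move=> [px _] [pq _]; have := primitive_onM pq px.
by apply: primitive_on_ext => // t _; ring.
Qed.

Lemma switching_second_derivative T c (x0 : R) alpha u x q :
  state_of T c x0 u x -> costate_of T alpha u q ->
  primitive_on 0 T (fun t => u t * (c * q t + alpha * x t) - 2 * alpha * c)
    (fun t => c * q t - alpha * x t).
Proof.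
move=> [px _] [pq _]; have := primitive_onB (primitive_onZ c pq) (primitive_onZ alpha px).
by apply: primitive_on_ext => // t _; ring.
Qed.

Lemma singular_arc T c (x0 : R) alpha beta u x q a b : 0 < c -> 0 < alpha -> 0 < beta ->
  (forall t, 0 <= t <= T -> 0 <= u t) -> (forall t, 0 <= t <= T -> 0 <= x t) ->
  state_of T c x0 u x -> costate_of T alpha u q ->
  0 <= a -> b <= T -> (forall t, a <= t <= b -> q t * x t = beta) ->
  ae_const_on a b (Num.sqrt (alpha * c / beta)) u.
Proof.
move=> c0 al0 be0 u_ge0 x_ge0 sx sq a0 bT Sb.
have pS := primitive_onS a0 bT (switching_derivative sx sq).
have pD := primitive_onS a0 bT (switching_second_derivative sx sq).
have [M DM] := pD.1.2.
have D0 := primitive_on_cst_derivative pS (primitive_on_lipschitz pD DM) Sb.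
apply: ae_imply (primitive_on_cst_ae pD D0) => t /= H tab.
have := H tab; move: tab; rewrite in_itv /= => /andP[at_ tb].
have Dt := D0 t (introT andP (conj (ltW at_) tb)).
have St := Sb t (introT andP (conj (ltW at_) (ltW tb))).
have t0T : 0 <= t <= T by rewrite (le_trans a0) ?(le_trans _ bT) ?ltW.
have ut := u_ge0 _ t0T; have xt := x_ge0 _ t0T.
move=> E.
(* S' = 0 gives c q = alpha x, so S'' = 0 reads 2 alpha u x = 2 alpha c. With q x = beta this also
   gives alpha x^2 = c beta; eliminating x leaves u^2 = alpha c / beta, and u >= 0 selects the
   root. *)
have ux : u t * x t = c.
  apply: (mulfI (lt0r_neq0 al0)); nra.
have xx : alpha * x t ^+ 2 = c * beta by rewrite -St; nra.
have -> : alpha * c / beta = u t ^+ 2.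
  apply: (mulIf (lt0r_neq0 be0)); rewrite divfK ?lt0r_neq0 //.
  apply: (mulfI (lt0r_neq0 c0)).
  rewrite (_ : c * (u t ^+ 2 * beta) = u t ^+ 2 * (c * beta)); last by ring.
  rewrite -xx (_ : u t ^+ 2 * _ = alpha * (u t * x t) ^+ 2); last by ring.
  by rewrite ux; ring.
by rewrite sqrtr_sqr ger0_norm.
Qed.

End SwitchingFunction.

(** * Classification of the minimizers *)

Section OptimalStructure.
Context {R : realType}.
Local Notation mu := (@lebesgue_measure R).
Implicit Types (T c alpha beta sigma : R) (u v x y q : R -> R).

Lemma minimizer_structure T c (x0 : R) alpha beta (u1 : R) u x :
  0 < T -> 0 < c -> 0 <= x0 -> 0 < alpha -> 0 < beta -> 0 < u1 ->
  Num.sqrt (alpha * c / beta) <= u1 ->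
  measurable_fun `[0, T]%classic u -> (forall t, 0 <= t <= T -> 0 <= u t <= u1) ->
  state_of T c x0 u x -> minimizes T c x0 alpha beta u1 u x ->
  let us := Num.sqrt (alpha * c / beta) in
  exists t1 t2 : R, [/\ 0 < t1, t1 < t2 & t2 < T] /\
    (ae_const_on 0 T 0 u \/
     (ae_const_on 0 t1 u1 u /\ ae_const_on t1 T 0 u) \/
     (ae_const_on 0 t1 us u /\ ae_const_on t1 T 0 u) \/
     [/\ ae_const_on 0 t1 0 u, ae_const_on t1 t2 us u & ae_const_on t2 T 0 u] \/
     [/\ ae_const_on 0 t1 u1 u, ae_const_on t1 t2 us u & ae_const_on t2 T 0 u]).
Proof.
move=> T0 c0 x00 al0 be0 u10 us1 mu_ u01 sx opt us.
have bu := bounded_measurable_control mu_ u01.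
have [q [sq q_ge0]] := costate_of_exists (ltW T0) (ltW al0) bu.
have x_ge0 := state_of_ge0 (ltW c0) x00 bu sx.
have pmp := minimum_principle T0 (ltW c0) x00 mu_ u01 sx sq opt.
have pS := switching_derivative sx sq.
have pD := switching_second_derivative sx sq.
pose S t := q t * x t; rewrite -/S in pS.
have pmpE : {ae mu, forall t, t \in `[0, T] -> (beta < S t -> u t = u1) /\ (S t < beta -> u t = 0)} by [].
have ST : S T = 0 by rewrite /S sq.2 mul0r.
have arc_us a b : 0 <= a -> b <= T -> (forall t, a <= t <= b -> S t = beta) -> ae_const_on a b us u.
  by move=> a0 bT Sb; apply: (singular_arc c0 al0 be0 _ x_ge0 sx sq) => // t /u01 /andP[].
(* The exceptional time [e] allows S to touch beta at one instant without affecting the control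
   almost everywhere. *)
have arc_0 a b e : 0 <= a -> b <= T -> (forall t, a < t < b -> t != e -> S t < beta) -> ae_const_on a b 0 u.
  move=> a0 bT Sb; apply: ae_imply2 (@ae_neq R e) pmpE => t te H.
  rewrite in_itv /= => /andP[at_ tb].
  apply: (H _).2; last by apply: Sb; rewrite ?at_.
  by rewrite in_itv /= (le_trans a0) ?(le_trans _ bT) // ltW.
have arc_u1 a b : 0 <= a -> b <= T -> (forall t, a < t < b -> beta < S t) -> ae_const_on a b u1 u.
  move=> a0 bT Sb; apply: ae_imply pmpE => t H.
  rewrite in_itv /= => /andP[at_ tb].
  apply: (H _).1; last by apply: Sb; rewrite ?at_.
  by rewrite in_itv /= (le_trans a0) ?(le_trans _ bT) // ltW.
have oo_cc a b t : 0 <= a -> b <= T -> t \in `]a, b[ -> t \in `[0, T].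
  rewrite !in_itv /= => a0 bT /andP[at_ tb].
  by rewrite (le_trans a0) ?(le_trans _ bT) // ltW.
(* Below beta the control vanishes, leaving S'' = - 2 alpha c < 0. *)
have valley a b : 0 <= a -> b <= T -> beta <= S a -> beta <= S b ->
    forall t, a <= t <= b -> beta <= S t.
  move=> a0 bT; apply: concave_below_barrier; [exact: primitive_onS pS|exact: primitive_onS pD|].
  apply: ae_imply pmpE => t H tab St.
  rewrite ((H (oo_cc _ _ _ a0 bT tab)).2 St); nra.
(* On {S > beta}, AM-GM gives c q + alpha x >= 2 sqrt(alpha c S). *)
have peak a b : 0 <= a -> b <= T -> S a <= beta -> S b <= beta ->
    forall t, a <= t <= b -> S t <= beta.
  move=> a0 bT; apply: convex_above_barrier; [exact: primitive_onS pS|exact: primitive_onS pD|].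
  apply: ae_imply pmpE => t H tab St.
  have tT := oo_cc _ _ _ a0 bT tab; rewrite ((H tT).1 St).
  rewrite in_itv /= in tT; have qt := q_ge0 _ tT; have xt := x_ge0 _ tT.
  set z := c * q t + alpha * x t.
  have z0 : 0 <= z by rewrite addr_ge0 // mulr_ge0 // ltW.
  have zz : 4 * (alpha * c) * beta <= z ^+ 2.
    have h1 : z ^+ 2 = (c * q t - alpha * x t) ^+ 2 + 4 * (alpha * c) * S t.
      by rewrite /z /S; ring.
    have h2 : 4 * (alpha * c) * beta <= 4 * (alpha * c) * S t.
      by apply: ler_wpM2l; [rewrite !mulr_ge0 // ltW|exact: ltW].
    by have := sqr_ge0 (c * q t - alpha * x t); lra.
  have uu : alpha * c <= u1 ^+ 2 * beta.
    have h0 : 0 <= alpha * c / beta by rewrite divr_ge0 ?mulr_ge0 // ltW.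
    have : us ^+ 2 <= u1 ^+ 2 by rewrite lerXn2r ?nnegrE ?sqrtr_ge0 // ltW.
    by rewrite sqr_sqrtr // ler_pdivrMr.
  (* To show 2 alpha c <= u1 z, both sides are squared and multiplied by beta, so that [zz] and [uu]
     combine without square roots. *)
  rewrite subr_ge0 -(ler_pXn2r (n := 2)) ?nnegrE ?mulr_ge0 ?(ltW u10) ?(ltW al0) ?(ltW c0) //.
  rewrite -(ler_pM2r be0) !exprMn.
  have h3 : (u1 ^+ 2 * beta) * (4 * (alpha * c) * beta) <= (u1 ^+ 2 * beta) * z ^+ 2.
    by apply: ler_wpM2l => //; rewrite mulr_ge0 ?sqr_ge0 // ltW.
  have h4 : (alpha * c) * (4 * (alpha * c) * beta) <= (u1 ^+ 2 * beta) * (4 * (alpha * c) * beta).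
    by apply: ler_wpM2r => //; rewrite !mulr_ge0 // ltW.
  rewrite (_ : 2 ^+ 2 * alpha ^+ 2 * c ^+ 2 * beta = (alpha * c) * (4 * (alpha * c) * beta)); last by ring.
  rewrite (_ : u1 ^+ 2 * z ^+ 2 * beta = (u1 ^+ 2 * beta) * z ^+ 2); last by ring.
  exact: le_trans h4 h3.
have [M DM] := pS.1.2.
have lS := primitive_on_lipschitz pS DM.
have ge0_case : (forall t, 0 <= t <= T -> S t < beta) \/ exists2 t, 0 <= t <= T & beta <= S t.
  have [[t tT St]|H] := pselect (exists2 t, 0 <= t <= T & beta <= S t).
    by right; exists t.
  by left => t tT; rewrite ltNge; apply/negP => St; apply: H; exists t.
case: ge0_case => [Slt|[t0 /andP[t00 t0T] St0]].
  (* Placeholders: the zero control has no switching time, but the statement asks for two ordered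
     ones. *)
  exists (T / 3), (2 * T / 3); split; first by split; lra.
  left; apply: (arc_0 _ _ 0) => // t /andP[at_ tb] _; apply: Slt.
  by rewrite !ltW.
(* [t2] is the last time with S >= beta. It precedes [T] because S(T) = 0 < beta, so every remaining
   form ends with a zero arc. *)
have [|| t2 [/andP[t02 t2T] St2 after]] := @exists_last_ge0 R t0 T M (fun t => S t - beta) t0T.
- move=> s t /andP[s1 s2] /andP[r1 r2].
  rewrite (_ : S t - beta - _ = S t - S s); last by ring.
  by apply: lS; rewrite ?s2 ?r2 ?andbT (le_trans t00).
- by rewrite subr_ge0.
rewrite subr_ge0 in St2.
have {}after t : t2 < t -> t <= T -> S t < beta.
  by move=> t2t tT; rewrite -subr_lt0; apply: after; rewrite t2t.
have t20 : 0 <= t2 by exact: le_trans t02.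
have {}t2T : t2 < T.
  by rewrite lt_neqAle t2T andbT; apply/eqP => E; move: St2; rewrite E ST leNgt be0.
have tail a : t2 <= a -> ae_const_on a T 0 u.
  move=> t2a; apply: (arc_0 _ _ 0) => //; first exact: le_trans t2a.
  by move=> t /andP[at_ tT] _; apply: after; [exact: le_lt_trans at_|exact: ltW].
(* The position of S(0) relative to beta decides whether the control starts with 0, [u1] or [us]. *)
have [S0|S0|S0] := ltgtP (S 0) beta.
- have [|| t1 [/andP[t10 t12] St1 before]] := @exists_first_ge0 R 0 t2 M (fun t => S t - beta) t20.
  + move=> s t /andP[s1 s2] /andP[r1 r2].
    rewrite (_ : S t - beta - _ = S t - S s); last by ring.
    by apply: lS; rewrite ?s1 ?r1 /= ltW // (le_lt_trans _ t2T).
  + by rewrite subr_ge0.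
  rewrite subr_ge0 in St1.
  have {}before t : 0 <= t -> t < t1 -> S t < beta.
    by move=> t0' tt1; rewrite -subr_lt0; apply: before; rewrite t0'.
  have {}t10 : 0 < t1.
    by rewrite lt_neqAle t10 andbT; apply/eqP => E; move: St1; rewrite -E leNgt S0.
  (* If the first and last times with S >= beta coincide, S only touches beta there and the control
     is zero almost everywhere. *)
  have [t12'|t21] := ltP t1 t2; last first.
    exists (T / 3), (2 * T / 3); split; first by split; lra.
    left; apply: (arc_0 _ _ t1) => // t /andP[at_ tb]; rewrite neq_lt => /orP[tt|tt].
      by apply: before => //; exact: ltW.
    by apply: after; [exact: le_lt_trans tt|exact: ltW].
  exists t1, t2; split=> //; do 3 right; left; split; last exact: tail.
    apply: (arc_0 _ _ 0) => //; first by rewrite ltW // (lt_trans t12').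
    by move=> t /andP[at_ tb] _; apply: before => //; exact: ltW.
  apply: arc_us; [exact: ltW|exact: ltW|] => t /andP[t1t tt2].
  apply/eqP; rewrite eq_le; apply/andP; split.
    apply: (peak 0 T) => //; rewrite ?ST ?(ltW S0) ?(ltW be0) //.
    by rewrite (le_trans (ltW t10)) // (le_trans tt2) // ltW.
  by apply: (valley t1 t2); rewrite ?t1t ?(ltW t10) ?(ltW t2T).
- have [|| t1 [/andP[t10 t1T] St1 before]] := @exists_first_ge0 R 0 T M (fun t => beta - S t) (ltW T0).
  + move=> s t s1 r1.
    rewrite (_ : beta - S t - _ = - (S t - S s)); last by ring.
    by rewrite normrN lS.
  + by rewrite ST subr0 ltW.
  rewrite subr_ge0 in St1.
  have {}before t : 0 <= t -> t < t1 -> beta < S t.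
    by move=> t0' tt1; rewrite -subr_lt0; apply: before; rewrite t0'.
  have {}t10 : 0 < t1.
    by rewrite lt_neqAle t10 andbT; apply/eqP => E; move: St1; rewrite -E leNgt S0.
  (* Otherwise the midpoint would lie both before [t1], where S > beta, and after [t2], where S <
     beta. *)
  have t12 : t1 <= t2.
    rewrite leNgt; apply/negP => t21.
    have := before ((t1 + t2) / 2); have := after ((t1 + t2) / 2).
    move=> h1 h2; have : beta < S ((t1 + t2) / 2) by apply: h2; lra.
    by apply/negP; rewrite -leNgt ltW // h1; lra.
  have head : ae_const_on 0 t1 u1 u.
    by apply: arc_u1 => // t /andP[at_ tb]; apply: before => //; exact: ltW.
  have [t12'|t21] := ltP t1 t2; last first.
    exists t1, ((t1 + T) / 2); split; first by split=> //; lra.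
    by right; left; split => //; apply: tail.
  exists t1, t2; split=> //; do 4 right; split; [by []| |exact: tail].
  apply: arc_us; [exact: ltW|exact: ltW|] => t /andP[t1t tt2].
  apply/eqP; rewrite eq_le; apply/andP; split.
    (* Each barrier needs endpoints on its own side: S <= beta at [t1] and [T] for [peak], S >= beta
       at 0 and [t2] for [valley]. *)
    apply: (peak t1 T) => //; rewrite ?ST ?(ltW t10) ?(ltW be0) //.
    by rewrite t1t (le_trans tt2) // ltW.
  apply: (valley 0 t2) => //; [exact: ltW|exact: ltW|].
  by rewrite tt2 (le_trans (ltW t10)).
- have [t20'|t2le] := ltP 0 t2; last first.
    exists (T / 3), (2 * T / 3); split; first by split; lra.
    left; apply: (arc_0 _ _ 0) => // t /andP[at_ tb] _.
    by apply: after; [exact: le_lt_trans at_|exact: ltW].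
  exists t2, ((t2 + T) / 2); split; first by split=> //; lra.
  do 2 right; left; split; last exact: tail.
  apply: arc_us => //; first exact: ltW.
  move=> t /andP[t0t tt2]; apply/eqP; rewrite eq_le; apply/andP; split.
    apply: (peak 0 T) => //; rewrite ?ST ?S0 ?(ltW be0) //.
    by rewrite t0t (le_trans tt2) // ltW.
  by apply: (valley 0 t2); rewrite ?S0 ?(ltW t2T) ?t0t.
Qed.

End OptimalStructure.

(** * From almost everywhere constraints to pointwise ones *)

Section Normalization.
Context {R : realType}.
Local Notation mu := (@lebesgue_measure R).
Implicit Types (T N alpha beta sigma : R) (u v x y : R -> R).

Lemma state_of_is_state T (x0 : R) N sigma u x :
  state_of T (N * sigma ^+ 2) x0 u x -> is_state T x0 N sigma u x.
Proof.
move=> [px x0E]; split; first exact: primitive_on_continuous px.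
move=> t; rewrite in_itv /= => /andP[t0 tT].
by have := px.2 _ _ (lexx 0) t0 tT; rewrite x0E => <-; ring.
Qed.

(** A bounded representative [v] of the control has the same state: [x] is continuous, hence
    bounded, so the integrand for [v] is bounded measurable, and integrals ignore null sets. *)
Lemma is_state_state_of T (x0 : R) N sigma u v x : 0 <= T ->
  measurable_fun `[0, T]%classic u -> bounded_measurable 0 T v ->
  {ae mu, forall t, t \in `[0, T] -> v t = u t} ->
  is_state T x0 N sigma u x -> state_of T (N * sigma ^+ 2) x0 v x.
Proof.
move=> T0 mu_ bv vu [cx xE].
have bx := within_continuous_bounded_measurable cx.
have bh : bounded_measurable 0 T (fun t => - v t * x t + N * sigma ^+ 2).
  apply: bounded_measurableD; last exact: bounded_measurable_cst.
  by apply: bounded_measurableM => //; apply: bounded_measurableN.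
have mh : measurable_fun `[0, T]%classic (fun t => - u t * x t + N * sigma ^+ 2).
  apply: measurable_funD; last exact: measurable_cst.
  apply: measurable_funM; last exact: bx.1.
  exact: measurableT_comp.
split.
  apply: primitive_on_ext (primitive_on_integral x0 bh) => // t tT.
  rewrite xE; last by rewrite in_itv.
  have [t0 tT'] := andP tT.
  rewrite (ae_eq_integral_segment _ tT' bh mh) //.
  by apply: ae_imply vu => r H rT; rewrite H.
by rewrite xE ?in_itv /= ?lexx // set_itv1 Rintegral_set1 addr0.
Qed.

Lemma cost_EFin T alpha beta u v x : bounded_measurable 0 T v ->
  bounded_measurable 0 T x -> measurable_fun `[0, T]%classic u ->
  {ae mu, forall t, t \in `[0, T] -> v t = u t} ->
  cost T alpha beta u x = (\int[mu]_(t in `[0, T]) (alpha * x t + beta * v t))%:E.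
Proof.
move=> bv bx mu_ vu.
have bh : bounded_measurable 0 T (fun t => alpha * x t + beta * v t).
  by apply: bounded_measurableD; apply: bounded_measurableZ.
have mh : measurable_fun `[0, T]%classic (fun t => alpha * x t + beta * u t).
  apply: measurable_funD; apply: measurable_funM => //; exact: bx.1.
rewrite /Rintegral fineK; last first.
  by apply: integrable_fin_num => //; exact: bounded_measurable_integrable bh.
apply: ae_eq_integral => //.
- by apply/measurable_EFinP.
- by apply/measurable_EFinP; exact: bh.1.
- by apply: ae_imply vu => t H tT; rewrite /= H.
Qed.

(* Clamping the values makes the control constraint hold everywhere. *)
Lemma optimal_minimizes T alpha beta sigma (u1 : R) (x0 : R) N u x :
  0 <= T -> 0 <= u1 -> optimal T alpha beta sigma u1 x0 N u x ->
  exists v, [/\ measurable_fun `[0, T]%classic v,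
    forall t, 0 <= t <= T -> 0 <= v t <= u1,
    {ae mu, forall t, t \in `[0, T] -> v t = u t},
    state_of T (N * sigma ^+ 2) x0 v x &
    minimizes T (N * sigma ^+ 2) x0 alpha beta u1 v x].
Proof.
move=> T0 u10 [[mu_ u01] [sx opt]].
pose v t := Num.max 0 (Num.min (u t) u1).
have mv : measurable_fun `[0, T]%classic v.
  apply: measurable_maxr; first exact: measurable_cst.
  by apply: measurable_minr => //; exact: measurable_cst.
have v01 t : 0 <= t <= T -> 0 <= v t <= u1.
  by move=> _; rewrite /v le_max lexx /= ge_max u10 ge_min lexx orbT.
have vu : {ae mu, forall t, t \in `[0, T] -> v t = u t}.
  apply: ae_imply u01 => t H tT; have /andP[a1 a2] := H tT.
  by rewrite /v min_l // max_r.
have bv := bounded_measurable_control mv v01.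
have sv := is_state_state_of T0 mu_ bv vu sx.
exists v; split => // w y mw w01 sy.
have bw := bounded_measurable_control mw w01.
rewrite -lee_fin -(cost_EFin alpha beta bv (state_of_bounded_measurable sv) mu_ vu).
rewrite -(cost_EFin alpha beta bw (state_of_bounded_measurable sy) mw); last first.
  exact: aeW.
apply: opt; last exact: state_of_is_state.
split => //; apply: aeW => t; rewrite in_itv /=; exact: w01.
Qed.

Lemma ae_const_on_eq T a b k u v : 0 <= a -> b <= T ->
  {ae mu, forall t, t \in `[0, T] -> v t = u t} ->
  ae_const_on a b k v -> ae_const_on a b k u.
Proof.
move=> a0 bT; apply: ae_imply2 => t vu vk tab; rewrite -vu ?vk //.
move: tab; rewrite !in_itv /= => /andP[at_ tb].
by rewrite (le_trans a0) ?(le_trans _ bT) // ltW.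
Qed.

End Normalization.

Unset Implicit Arguments.

Theorem theorem2 (R : realType) (T alpha beta sigma u1 R0 : R) (N : nat)
  (hT : 0 < T) (halpha : 0 < alpha) (hbeta : 0 < beta) (hsigma : 0 < sigma)
  (hu1 : 0 < u1) (hN : (0 < N)%N) (hR0 : 0 <= R0)
  (hus : Num.sqrt (alpha * N%:R * sigma ^+ 2 / beta) <= u1)
  (u x : R -> R) :
  optimal T alpha beta sigma u1 R0 N%:R u x ->
  let us := Num.sqrt (alpha * N%:R * sigma ^+ 2 / beta) in
  exists t1 t2 : R, [/\ 0 < t1, t1 < t2 & t2 < T] /\
    ( (* (2.1) *) ae_const_on 0 T 0 u \/
      (* (2.2) *) (ae_const_on 0 t1 u1 u /\ ae_const_on t1 T 0 u) \/
      (* (2.3) *) (ae_const_on 0 t1 us u /\ ae_const_on t1 T 0 u) \/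
      (* (2.4) *) [/\ ae_const_on 0 t1 0 u, ae_const_on t1 t2 us u & ae_const_on t2 T 0 u] \/
      (* (2.5) *) [/\ ae_const_on 0 t1 u1 u, ae_const_on t1 t2 us u & ae_const_on t2 T 0 u]).
Proof.
move=> opt.
have c0 : 0 < N%:R * sigma ^+ 2 by rewrite mulr_gt0 ?exprn_gt0 // ltr0n.
have [v [mv v01 vu sv min]] := optimal_minimizes (ltW hT) (ltW hu1) opt.
(* Regrouping exposes the constant c = N sigma^2 under the root. *)
rewrite -(mulrA alpha) in hus *.
have [t1 [t2 [[t10 t12 t2T] H]]] :=
  minimizer_structure hT c0 hR0 halpha hbeta hu1 hus mv v01 sv min.
exists t1, t2; split=> //.
have tr a b k : 0 <= a -> b <= T -> ae_const_on a b k v -> ae_const_on a b k u.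
  by move=> a0 bT; exact: ae_const_on_eq vu.
have t1T := lt_trans t12 t2T; have t20 := lt_trans t10 t12.
case: H => [H|[[H1 H2]|[[H1 H2]|[[H1 H2 H3]|[H1 H2 H3]]]]].
- by left; apply: tr H.
- right; left; split; [apply: tr H1|apply: tr H2]; do ?[exact: lexx]; exact: ltW.
- do 2 right; left; split; [apply: tr H1|apply: tr H2]; do ?[exact: lexx]; exact: ltW.
- do 3 right; left; split; [apply: tr H1|apply: tr H2|apply: tr H3]; do ?[exact: lexx]; exact: ltW.
- do 4 right; split; [apply: tr H1|apply: tr H2|apply: tr H3]; do ?[exact: lexx]; exact: ltW.
Qed.
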